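(* Reflexive sets (sets $X$ with $X\in X$) exist. Moreover, given elements $x_0,x_1,\dots,x_\lambda,\dots$ of $\mathbf{U}$ such that $\{x_0,x_1,\dots,x_\lambda,\dots\}$ is a well-founded set (possibly empty), the equation $$X=\{x_0,x_1,x_2,\dots,x_\lambda,\dots,X\}$$ in the unknown set $X$ has many different solutions in $\mathbf{V}[\mathcal U]^-$; these solutions form a proper class.
   Context: Work in von Neumann–Bernays–Gödel class theory without the axiom of foundation (possibly with a class $\mathcal U$ of individuals/atoms). $\mathbf{V}[\mathcal U]^-$ is the class of all sets of this theory; $\mathbf{V}[\mathcal U]$ is the class of well-founded sets; $\mathbf{U}=\mathbf{V}[\mathcal U]\cup\mathcal U$. Skands. For ordinals $\alpha_0<\alpha$ let $(\alpha_0,\alpha)=\{\alpha' : \alpha_0\le\alpha'<\alpha\}$. A skand $X_{(\alpha_0,\alpha)}$ is given by a family $(X_{\alpha'})_{\alpha_0\le\alpha'<\alpha}$ of (possibly empty) well-founded sets $X_{\alpha'}\in\mathbf V[\mathcal U]$, called its components; it is thought of as a well-ordered system of nested curly braces $\{x^{\alpha_0}_0,x^{\alpha_0}_1,\dots,\{x^{\alpha_0+1}_0,x^{\alpha_0+1}_1,\dots,\{\dots\}\}\}$ whose $\alpha'$-th level contains the elements of $X_{\alpha'}$. Its length is the ordinal $\alpha-\alpha_0$ (the order type of $(\alpha_0,\alpha)$). For $\alpha_0<\alpha_1<\alpha$, $X_{(\alpha_1,\alpha)}$ denotes the skand with components $X_{\alpha'}$, $\alpha_1\le\alpha'<\alpha$.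 Axiom of skand existence (assumed): every such family determines a skand which is a set, the elements of the set $X_{(\alpha_0,\alpha)}$ being the elements of $X_{\alpha_0}$ together with one further element, the skand $X_{(\alpha_0+1,\alpha)}$ (when $\alpha_0+1<\alpha$; a skand of length $1$ is just the set $X_{\alpha_0}$). Equality of skands (assumed as criterion of equality for skands of infinite length): $X_{(\alpha_0,\alpha)}=Y_{(\beta_0,\beta)}$ if and only if the well-ordered sets $(\alpha_0,\alpha)$ and $(\beta_0,\beta)$ are isomorphic and, under the unique isomorphism $\varphi$, $X_{\alpha'}=Y_{\varphi(\alpha')}$ for all $\alpha'$. *)

(* Defs.v *)
Set Implicit Arguments.
Unset Strict Implicit.
Unset Printing Implicit Defensive.

(* The objects are the classes together with the individuals (atoms);
   [individuals] is the class of all individuals, which may be empty, a nonempty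
   set or a proper class. *)
Record class_structure : Type := ClassStructure {
  obj :> Type;
  mem : obj -> obj -> Prop;
  individuals : obj
}.

Arguments individuals : clear implicits.

Notation "x ∈ y" := (mem x y) (at level 70, no associativity).
Notation "x ∉ y" := (~ mem x y) (at level 70, no associativity).

Section BasicNotions.

Variable M : class_structure.
Implicit Types x y z a b p s t X Y F R : M.

Definition is_class X := X ∉ individuals M.
Definition is_element x := exists C : M, x ∈ C.
Definition is_set X := is_class X /\ is_element X.
Definition is_proper_class X := is_class X /\ ~ is_element X.

Definition subclass X Y := forall z, z ∈ X -> z ∈ Y.
Definition is_empty X := is_class X /\ forall z, z ∉ X.

Definition is_pair z x y :=
  is_class z /\ forall w : M, w ∈ z <-> w = x \/ w = y.

(* Kuratowski pair {{x}, {x, y}}.  Asking for the witnesses [a] and [b] forces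
   [x] and [y] to be sets or individuals. *)
Definition is_opair p x y :=
  exists a b, is_pair a x x /\ is_pair b x y /\ is_pair p a b.

Definition related R x y := exists p, is_opair p x y /\ p ∈ R.

Definition functional F :=
  forall x y y', related F x y -> related F x y' -> y = y'.

(* s = x ∪ {x} *)
Definition is_succ s x :=
  is_class s /\ forall z, z ∈ s <-> z ∈ x \/ z = x.

End BasicNotions.

(* First-order formulas with de Bruijn variables. *)
Inductive formula : Type :=
| FMem (i j : nat)
| FEq (i j : nat)
| FNot (phi : formula)
| FAnd (phi psi : formula)
| FOr (phi psi : formula)
| FImp (phi psi : formula)
| FAll (phi : formula)
| FEx (phi : formula).

Definition scons (T : Type) (x : T) (e : nat -> T) (n : nat) : T :=
  match n with 0 => x | S m => e m end.

(* Quantifiers range over sets and individuals only, so that comprehension below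
   is predicative; the free variables may denote arbitrary classes. *)
Fixpoint sat (M : class_structure) (e : nat -> M) (phi : formula) : Prop :=
  match phi with
  | FMem i j => e i ∈ e j
  | FEq i j => e i = e j
  | FNot f => ~ sat e f
  | FAnd f g => sat e f /\ sat e g
  | FOr f g => sat e f \/ sat e g
  | FImp f g => sat e f -> sat e g
  | FAll f => forall x : M, is_element x -> sat (scons x e) f
  | FEx f => exists x : M, is_element x /\ sat (scons x e) f
  end.

(* Von Neumann-Bernays-Goedel class theory with individuals and without
   foundation.  No choice principle is assumed.  Separation is the instance of
   replacement for a partial identity. *)
Record NBG (M : class_structure) : Prop := {
  individuals_are_a_class : is_class (individuals M);
  individuals_memberless : forall a x : M, a ∈ individuals M -> x ∉ a;
  extensionality : forall X Y : M, is_class X -> is_class Y ->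
    (forall z, z ∈ X <-> z ∈ Y) -> X = Y;
  comprehension : forall (phi : formula) (e : nat -> M),
    exists C : M, is_class C /\
      forall x, is_element x -> (x ∈ C <-> sat (scons x e) phi);
  pairing : forall x y : M, is_element x -> is_element y ->
    exists z : M, is_set z /\ is_pair z x y;
  union : forall X : M, is_set X ->
    exists Y : M, is_set Y /\ forall z, z ∈ Y <-> exists y, z ∈ y /\ y ∈ X;
  powerset : forall X : M, is_set X ->
    exists Y : M, is_set Y /\ forall z, z ∈ Y <-> is_set z /\ subclass z X;
  infinity : exists I : M, is_set I /\
    (exists z, is_empty z /\ z ∈ I) /\
    (forall x, x ∈ I -> exists s, is_succ s x /\ s ∈ I);
  replacement : forall F X : M, is_class F -> functional F -> is_set X ->
    exists Y : M, is_set Y /\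
      forall y, y ∈ Y <-> exists x, x ∈ X /\ related F x y
}.

Section Skands.

Variable M : class_structure.
Implicit Types x y z s t X Y f g phi Sk : M.
Implicit Types alpha beta gamma delta lambda : M.

Definition transitive t := forall x, x ∈ t -> subclass x t.

Definition mem_well_founded_on t :=
  forall s, subclass s t -> (exists x, x ∈ s) ->
    exists m : M, m ∈ s /\ forall z, z ∈ s -> z ∉ m.

(* ∈ is well-founded on the transitive closure of X. *)
Definition well_founded_set X :=
  is_set X /\
  exists t, is_set t /\ transitive t /\ subclass X t /\ mem_well_founded_on t.

(* U = V[𝒰] ∪ 𝒰 *)
Definition in_U x := well_founded_set x \/ x ∈ individuals M.

(* The elements are required to be classes in order to exclude, for instance,
   the singleton of an individual. *)
Definition ordinal alpha :=
  is_set alpha /\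
  (forall x, x ∈ alpha -> is_class x) /\
  transitive alpha /\
  (forall x y, x ∈ alpha -> y ∈ alpha -> x ∈ y \/ x = y \/ y ∈ x) /\
  mem_well_founded_on alpha.

Definition ord_le alpha beta := alpha = beta \/ alpha ∈ beta.

(* A natural number: neither it nor any smaller ordinal is a nonzero limit. *)
Definition finite_ordinal alpha :=
  ordinal alpha /\
  forall beta, ord_le beta alpha ->
    is_empty beta \/ exists gamma, is_succ beta gamma.

(* (α₀, α) = {γ : α₀ ≤ γ < α}, with the left end point included *)
Definition interval alpha0 alpha gamma :=
  ordinal gamma /\ ord_le alpha0 gamma /\ gamma ∈ alpha.

Definition order_iso (P Q : M -> Prop) phi :=
  is_set phi /\
  (forall p, p ∈ phi ->
     exists gamma delta, is_opair p gamma delta /\ P gamma /\ Q delta) /\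
  (forall gamma, P gamma -> exists! delta, related phi gamma delta) /\
  (forall delta, Q delta -> exists! gamma, related phi gamma delta) /\
  (forall gamma gamma' delta delta',
     related phi gamma delta -> related phi gamma' delta' ->
     (gamma ∈ gamma' <-> delta ∈ delta')).

Definition has_length alpha0 alpha lambda :=
  ordinal lambda /\
  exists phi,
    order_iso (fun gamma => gamma ∈ lambda) (interval alpha0 alpha) phi.

Definition infinite_length alpha0 alpha :=
  exists lambda, has_length alpha0 alpha lambda /\ ~ finite_ordinal lambda.

(* f is the family of components of a skand over (α₀, α), as a set of ordered
   pairs. *)
Definition component_family alpha0 alpha f :=
  ordinal alpha0 /\ ordinal alpha /\ alpha0 ∈ alpha /\
  is_set f /\
  (forall p, p ∈ f -> exists gamma x,
     is_opair p gamma x /\ interval alpha0 alpha gamma) /\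
  (forall gamma, interval alpha0 alpha gamma -> exists! x, related f gamma x) /\
  (forall gamma x, related f gamma x -> well_founded_set x).

(* g is the restriction of f to the indices γ ≥ α₁. *)
Definition is_tail_family f alpha1 g :=
  is_class g /\
  forall p, p ∈ g <->
    p ∈ f /\ exists gamma x, is_opair p gamma x /\ ord_le alpha1 gamma.

(* A skand is not determined by the membership relation alone (one and the same
   recursive membership pattern may be realised by several sets), so the
   assignment of skands to families is a datum: a class [Sk] of ordered pairs
   (f, X), where [related Sk f X] means that X is the skand with components f. *)
Definition skand_existence Sk :=
  is_class Sk /\
  forall alpha0 alpha f, component_family alpha0 alpha f ->
    (exists! X, related Sk f X) /\
    (forall X X0, related Sk f X -> related f alpha0 X0 ->
       is_set X /\
       forall y, y ∈ X <->
         y ∈ X0 \/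
         exists alpha1 g, is_succ alpha1 alpha0 /\ alpha1 ∈ alpha /\
           is_tail_family f alpha1 g /\ related Sk g y).

Definition skand_equality Sk :=
  forall alpha0 alpha beta0 beta f g X Y,
    component_family alpha0 alpha f -> infinite_length alpha0 alpha ->
    component_family beta0 beta g -> infinite_length beta0 beta ->
    related Sk f X -> related Sk g Y ->
    (X = Y <->
     exists phi,
       order_iso (interval alpha0 alpha) (interval beta0 beta) phi /\
       forall gamma delta x y, related phi gamma delta ->
         related f gamma x -> related g delta y -> x = y).

(* X = A ∪ {X}, where A = {x₀, x₁, …, x_λ, …} *)
Definition solves_reflexive_equation (A X : M) :=
  is_set X /\ forall y, y ∈ X <-> y ∈ A \/ y = X.

End Skands.

(* Main.v *)
(** For an infinite ordinal [a], let X be the skand over (0, a) all of whose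
    components are A.  Its elements are those of A and the skand over (1, a) with
    all components A.  Since 1 + a = a, these two skands are equal, so
    X = A ∪ {X}.  Skands obtained from distinct [a] are distinct because
    isomorphic ordinals are equal; if the solutions formed a set, replacement
    would thus give a set of all infinite ordinals, contradicting Burali-Forti. *)

Require Import Defs.
From Stdlib Require Import Classical.

(** Comprehension is available only for syntactic formulas whose quantifiers range over sets and
    individuals. Hence every class formed below needs a proof that its defining condition is
    expressible in this way, and notions that quantify over all objects or over all subclasses are
    first replaced by equivalent bounded ones. Without foundation, cycles of membership among
    ordinals are excluded only through the well-foundedness built into the definition of an ordinal.
    Infinite lengths matter twice: only there can the interval from 0 be mapped isomorphically onto
    the interval from 1, and only there is the criterion of equality assumed. Replacement runs from
    solutions to lengths; this assignment is partial, since nothing says that every solution is a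
    skand with constant components. *)

Section ClassTheory.

Context {M : class_structure} (hM : NBG M).
Implicit Types x y z a b c f g m n p s t w A R Sk X Y : M.

(** * Definability by predicative formulas *)

Lemma mem_element x X : x ∈ X -> is_element x.
Proof. now exists X. Qed.

Lemma mem_class x X : x ∈ X -> is_class X.
Proof. intros h hX; exact (individuals_memberless hM hX h). Qed.

(* An environment is any sequence of objects holding the class of individuals
   somewhere; leaving its position [k] free makes definability stable under
   quantification. *)
Definition definable (P : (nat -> M) -> Prop) :=
  forall k, exists phi,
    forall e, e k = individuals M -> (sat e phi <-> P e).

Lemma definable_ext (P Q : (nat -> M) -> Prop) :
  (forall e, P e <-> Q e) -> definable P -> definable Q.
Proof.
intros h hP k; destruct (hP k) as [phi hphi]; exists phi; intros e he.
rewrite (hphi e he); apply h.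
Qed.

Lemma definable_mem i j : definable (fun e => e i ∈ e j).
Proof. intro k; exists (FMem i j); intros; simpl; tauto. Qed.

Lemma definable_eq i j : definable (fun e => e i = e j).
Proof. intro k; exists (FEq i j); intros; simpl; tauto. Qed.

(** The one atomic notion that mentions the individuals; its formula refers to them through position
    [k]. *)
Lemma definable_class i : definable (fun e => is_class (e i)).
Proof.
intro k; exists (FNot (FMem i k)); intros e he; unfold is_class; simpl.
rewrite he; tauto.
Qed.

Lemma definable_not (P : (nat -> M) -> Prop) :
  definable P -> definable (fun e => ~ P e).
Proof.
intros hP k; destruct (hP k) as [f hf]; exists (FNot f); intros e he; simpl.
rewrite (hf e he); tauto.
Qed.

Lemma definable_and (P Q : (nat -> M) -> Prop) :
  definable P -> definable Q -> definable (fun e => P e /\ Q e).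
Proof.
intros hP hQ k; destruct (hP k) as [f hf]; destruct (hQ k) as [g hg].
exists (FAnd f g); intros e he; simpl.
rewrite (hf e he), (hg e he); tauto.
Qed.

Lemma definable_or (P Q : (nat -> M) -> Prop) :
  definable P -> definable Q -> definable (fun e => P e \/ Q e).
Proof.
intros hP hQ k; destruct (hP k) as [f hf]; destruct (hQ k) as [g hg].
exists (FOr f g); intros e he; simpl.
rewrite (hf e he), (hg e he); tauto.
Qed.

Lemma definable_imp (P Q : (nat -> M) -> Prop) :
  definable P -> definable Q -> definable (fun e => P e -> Q e).
Proof.
intros hP hQ k; destruct (hP k) as [f hf]; destruct (hQ k) as [g hg].
exists (FImp f g); intros e he; simpl.
rewrite (hf e he), (hg e he); tauto.
Qed.

Lemma definable_iff (P Q : (nat -> M) -> Prop) :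
  definable P -> definable Q -> definable (fun e => P e <-> Q e).
Proof. intros hP hQ; apply definable_and; apply definable_imp; assumption. Qed.

(** A quantifier of the metatheory ranges over all objects, [FAll] only over elements. The two agree
    when the body holds at every non-element, as it does for quantifiers bounded by a membership. *)
Lemma definable_forall (Q : (nat -> M) -> M -> Prop) :
  (forall e x, ~ is_element x -> Q e x) ->
  definable (fun e => Q (fun n : nat => e (S n)) (e 0)) ->
  definable (fun e => forall x, Q e x).
Proof.
(* Under the quantifier the individuals move up by one position. *)
intros hQ h k; destruct (h (S k)) as [f hf].
exists (FAll f); intros e he; simpl; split.
- intros hs x; destruct (classic (is_element x)) as [hx|hx]; [|now apply hQ].
  exact (proj1 (hf (scons x e) he) (hs x hx)).
- intros hs x _; exact (proj2 (hf (scons x e) he) (hs x)).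
Qed.

Lemma definable_exists (Q : (nat -> M) -> M -> Prop) :
  (forall e x, Q e x -> is_element x) ->
  definable (fun e => Q (fun n : nat => e (S n)) (e 0)) ->
  definable (fun e => exists x, Q e x).
Proof.
intros hQ h k; destruct (h (S k)) as [f hf].
exists (FEx f); intros e he; simpl; split.
- intros [x [_ hs]]; exists x; exact (proj1 (hf (scons x e) he) hs).
- intros [x hs]; exists x; split; [exact (hQ e x hs)|].
  exact (proj2 (hf (scons x e) he) hs).
Qed.

(** * Pairs and ordered pairs *)

Lemma pair_element_l z x y : is_pair z x y -> is_element x.
Proof. intros [_ h]; exists z; apply h; now left. Qed.

Lemma pair_element_r z x y : is_pair z x y -> is_element y.
Proof. intros [_ h]; exists z; apply h; now right. Qed.

Lemma pair_set z x y : is_pair z x y -> is_set z.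
Proof.
intros h; destruct (pairing hM (pair_element_l _ _ _ h) (pair_element_r _ _ _ h))
  as [z' [hz' [_ h2]]].
destruct h as [hc h].
replace z with z'; [exact hz'|].
apply (extensionality hM); [apply hz'|exact hc|].
intro u; rewrite h, h2; tauto.
Qed.

Lemma opair_set p x y : is_opair p x y -> is_set p.
Proof. intros [a [b [_ [_ h]]]]; exact (pair_set _ _ _ h). Qed.

Lemma opair_element p x y : is_opair p x y -> is_element p.
Proof. intro h; apply (opair_set _ _ _ h). Qed.

Lemma opair_element_l p x y : is_opair p x y -> is_element x.
Proof. intros [a [b [h _]]]; exact (pair_element_l _ _ _ h). Qed.

Lemma opair_element_r p x y : is_opair p x y -> is_element y.
Proof. intros [a [b [_ [h _]]]]; exact (pair_element_r _ _ _ h). Qed.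

Lemma opair_exists x y :
  is_element x -> is_element y -> exists p, is_opair p x y.
Proof.
intros hx hy.
destruct (pairing hM hx hx) as [a [ha ha']].
destruct (pairing hM hx hy) as [b [hb hb']].
destruct (pairing hM (proj2 ha) (proj2 hb)) as [p [_ hp]].
now exists p, a, b.
Qed.

Lemma pair_unique z z' x y : is_pair z x y -> is_pair z' x y -> z = z'.
Proof.
intros [hz h] [hz' h']; apply (extensionality hM); auto.
intro u; rewrite h, h'; tauto.
Qed.

Lemma opair_unique p q x y : is_opair p x y -> is_opair q x y -> p = q.
Proof.
intros [a [b [ha [hb hp]]]] [a' [b' [ha' [hb' hq]]]].
rewrite (pair_unique _ _ _ _ ha' ha) in hq.
rewrite (pair_unique _ _ _ _ hb' hb) in hq.
exact (pair_unique _ _ _ _ hp hq).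
Qed.

Lemma pair_inj z x y x' y' : is_pair z x y -> is_pair z x' y' ->
  (x = x' /\ y = y') \/ (x = y' /\ y = x').
Proof.
intros [_ h] [_ h'].
assert (h1 : x ∈ z) by (apply h; auto).
assert (h2 : y ∈ z) by (apply h; auto).
assert (h3 : x' ∈ z) by (apply h'; auto).
assert (h4 : y' ∈ z) by (apply h'; auto).
apply h' in h1; apply h' in h2; apply h in h3; apply h in h4.
intuition congruence.
Qed.

Lemma opair_inj p x y x' y' :
  is_opair p x y -> is_opair p x' y' -> x = x' /\ y = y'.
Proof.
intros [a [b [ha [hb hp]]]] [a' [b' [ha' [hb' hq]]]].
destruct (pair_inj _ _ _ _ _ hp hq) as [[<- <-]|[<- <-]].
- destruct (pair_inj _ _ _ _ _ ha ha'), (pair_inj _ _ _ _ _ hb hb');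
    intuition congruence.
- destruct (pair_inj _ _ _ _ _ ha hb'), (pair_inj _ _ _ _ _ hb ha');
    intuition congruence.
Qed.

Lemma related_element_l R x y : related R x y -> is_element x.
Proof. intros [p [h _]]; exact (opair_element_l _ _ _ h). Qed.

Lemma related_element_r R x y : related R x y -> is_element y.
Proof. intros [p [h _]]; exact (opair_element_r _ _ _ h). Qed.

(** [is_element] quantifies over arbitrary classes, out of reach of a formula; by pairing, an
    element already belongs to a set, its singleton. *)
Lemma definable_element i : definable (fun e => is_element (e i)).
Proof.
intro k; exists (FEx (FMem (S i) 0)); intros e _; simpl; split.
- intros [x [_ h]]; now exists x.
- intro h; destruct (pairing hM h h) as [z [hz hz']].
  exists z; split; [apply hz|]; apply hz'; now left.
Qed.

Ltac element_side :=
  solve [ eauto 2 using mem_element, pair_element_l, pair_element_r,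
            opair_element, opair_element_l, opair_element_r,
            related_element_l, related_element_r ].

Ltac destruct_all :=
  repeat match goal with
  | h : _ /\ _ |- _ => destruct h
  | h : exists _, _ |- _ => destruct h
  end.

(** Settles the conditions on non-elements: the quantified variable occurs in a membership, a pair
    or a relation, so it is an element, which is the goal or contradicts a hypothesis. *)
Ltac quantifier_side :=
  clear - hM; intros; unfold is_pair, is_succ, is_set in *; destruct_all;
  solve [ element_side
        | match goal with
          | h : ~ is_element _ |- _ =>
            try split; intros; try intro; destruct_all;
            exfalso; apply h; element_side
          end ].

Ltac definability_step :=
  cbv beta;
  first
  [ assumption
  | simple apply definable_mem | simple apply definable_eq
  | simple apply definable_class | simple apply definable_element
  | solve [auto with definability nocore]
  | simple apply definable_iff
  | simple apply definable_not | simple apply definable_and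
  | simple apply definable_or | simple apply definable_imp
  | apply definable_exists; [try quantifier_side|]
  | apply definable_forall; [try quantifier_side|] ].
Ltac definability := repeat definability_step.

(** The biconditional in [is_pair] fails at [w = e j] when [e j] is not an element, so its
    quantifier cannot simply be restricted to elements. Stating both memberships separately leaves a
    quantifier bounded by [e i]. *)
Lemma definable_pair i j k : definable (fun e => is_pair (e i) (e j) (e k)).
Proof.
apply definable_ext with (fun e => is_class (e i) /\ e j ∈ e i /\ e k ∈ e i /\
  forall w, w ∈ e i -> w = e j \/ w = e k).
- intro e; split; (intros [h h']; split; [assumption|]).
  + destruct h' as [h1 [h2 h3]]; intro w; split; [apply h3|].
    now intros [->| ->].
  + split; [apply h'; auto|split; [apply h'; auto|apply h']].
- definability.
Qed.
Hint Resolve definable_pair : definability.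

Lemma definable_opair i j k : definable (fun e => is_opair (e i) (e j) (e k)).
Proof.
apply definable_exists.
{ intros e a [b [h _]]; apply (pair_set _ _ _ h). }
apply definable_exists.
{ intros e b [_ [h _]]; apply (pair_set _ _ _ h). }
definability.
Qed.
Hint Resolve definable_opair : definability.

Lemma definable_related i j k : definable (fun e => related (e i) (e j) (e k)).
Proof. unfold related; definability. Qed.
Hint Resolve definable_related : definability.

Lemma definable_set i : definable (fun e => is_set (e i)).
Proof. unfold is_set; definability. Qed.
Hint Resolve definable_set : definability.

Lemma definable_subclass i j : definable (fun e => subclass (e i) (e j)).
Proof. unfold subclass; definability. Qed.
Hint Resolve definable_subclass : definability.

Lemma definable_empty i : definable (fun e => is_empty (e i)).
Proof. unfold is_empty; definability. Qed.
Hint Resolve definable_empty : definability.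

Lemma definable_ord_le i j : definable (fun e => ord_le (e i) (e j)).
Proof. unfold ord_le; definability. Qed.
Hint Resolve definable_ord_le : definability.

(** * Classes and sets from definable predicates with up to three parameters *)

Lemma class_of (P : M -> M -> M -> M -> Prop) a b c :
  definable (fun e => P (e 0) (e 1) (e 2) (e 3)) ->
  exists C, is_class C /\ forall x, x ∈ C <-> is_element x /\ P x a b c.
Proof.
(* Positions 0 to 3 hold [x], [a], [b], [c]; from position 4 on the environment is constantly the
   class of individuals. *)
intro hP; destruct (hP 4) as [phi h].
destruct (comprehension hM phi
  (scons a (scons b (scons c (fun _ => individuals M))))) as [C [hC h']].
exists C; split; [exact hC|].
intro x.
assert (hx : sat (scons x (scons a (scons b (scons c (fun _ => individuals M))))) phi
  <-> P x a b c) by (apply h; reflexivity).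
split.
- intro hxC; assert (is_element x) by now exists C.
  split; [assumption|]; apply hx, h'; assumption.
- intros [he hp]; apply h'; [assumption|]; now apply hx.
Qed.

(** Replacement for a definable functional relation. The positions are those inside
    [exists x y, is_opair p x y /\ ...]: [y] is 0, [x] is 1, [p] is 2, and the parameters follow. *)
Lemma image (P : M -> M -> M -> M -> M -> Prop) a b c X :
  definable (fun e => P (e 1) (e 0) (e 3) (e 4) (e 5)) ->
  (forall x y y', P x y a b c -> P x y' a b c -> y = y') -> is_set X ->
  exists Y, is_set Y /\
    forall y, y ∈ Y <-> exists x, x ∈ X /\ is_element y /\ P x y a b c.
Proof.
intros hP hf hX.
destruct (class_of (fun p a b c => exists x y, is_opair p x y /\ P x y a b c)
  a b c) as [F [hF hF']].
{ definability. }
assert (hr : forall x y, related F x y <->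
  is_element x /\ is_element y /\ P x y a b c).
{ intros x y; split.
  - intros [p [hp h]]; apply hF' in h; destruct h as [_ [x' [y' [hp' h]]]].
    destruct (opair_inj _ _ _ _ _ hp hp') as [-> ->].
    split; [|split]; [element_side|element_side|assumption].
  - intros [hx [hy h]]; destruct (opair_exists _ _ hx hy) as [p hp].
    exists p; split; [assumption|]; apply hF'; split; [element_side|eauto]. }
assert (hFf : functional F).
{ intros x y y' h h'; apply hr in h; apply hr in h'; apply (hf x); tauto. }
destruct (replacement hM hF hFf hX) as [Y [hY hY']].
exists Y; split; [exact hY|]; intro y; rewrite hY'; split.
- intros [x [hx h]]; apply hr in h; exists x; tauto.
- intros [x [hx h]]; exists x; split; [assumption|]; apply hr.
  split; [element_side|tauto].
Qed.

Lemma separation_class C X : is_set X ->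
  exists Y, is_set Y /\ forall x, x ∈ Y <-> x ∈ X /\ x ∈ C.
Proof.
intro hX.
destruct (image (fun x y C _ _ => x ∈ C /\ y = x) C C C X) as [Y [hY h]].
{ definability. }
{ intros x y y' [_ ->] [_ ->]; reflexivity. }
{ exact hX. }
exists Y; split; [exact hY|]; intro x; rewrite h; split.
- intros [x' [h1 [_ [h2 ->]]]]; auto.
- intros [h1 h2]; exists x; split; [|split]; auto; element_side.
Qed.

Lemma subclass_set X Y : is_set X -> is_class Y -> subclass Y X -> is_set Y.
Proof.
intros hX hY h; destruct (separation_class Y _ hX) as [Z [hZ hZ']].
replace Y with Z; [assumption|].
apply (extensionality hM); [apply hZ|assumption|]; intro z; rewrite hZ'.
split; [tauto|]; auto.
Qed.

Lemma separation (P : M -> M -> M -> M -> Prop) a b c X : is_set X ->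
  definable (fun e => P (e 0) (e 1) (e 2) (e 3)) ->
  exists Y, is_set Y /\ forall x, x ∈ Y <-> x ∈ X /\ P x a b c.
Proof.
intros hX hP; destruct (class_of P a b c hP) as [C [_ hC]].
destruct (separation_class C _ hX) as [Y [hY h]].
exists Y; split; [exact hY|]; intro x; rewrite h, hC; split; [tauto|].
intros [h1 h2]; repeat split; auto; element_side.
Qed.

(** The image of [X] under the map from [x] to the ordered pair of [x] and its value. Position 1
    holds this pair, and position 3 the auxiliary pair from the proof of [image]. *)
Lemma graph (P : M -> M -> M -> M -> M -> Prop) a b c X :
  definable (fun e => P (e 2) (e 0) (e 4) (e 5) (e 6)) ->
  (forall x y y', P x y a b c -> P x y' a b c -> y = y') -> is_set X ->
  exists F, is_set F /\ forall p, p ∈ F <->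
    exists x y, x ∈ X /\ is_opair p x y /\ P x y a b c.
Proof.
intros hP hf hX.
destruct (image (fun x p a b c => exists y, is_opair p x y /\ P x y a b c)
  a b c X) as [F [hF h]].
{ definability. }
{ intros x p p' [y [hp h]] [y' [hp' h']]; rewrite (hf _ _ _ h' h) in hp'.
  exact (opair_unique _ _ _ _ hp hp'). }
{ exact hX. }
exists F; split; [exact hF|]; intro p; rewrite h; split.
- intros [x [hx [_ [y [hp h']]]]]; eauto.
- intros [x [y [hx [hp h']]]]; exists x; split; [assumption|].
  split; [element_side|eauto].
Qed.

Lemma succ_exists x : is_set x -> exists s, is_set s /\ is_succ s x.
Proof.
intro hx; destruct (pairing hM (proj2 hx) (proj2 hx)) as [y [hy hy']].
destruct (pairing hM (proj2 hx) (proj2 hy)) as [z [hz hz']].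
destruct (union hM hz) as [s [hs hs']].
exists s; split; [exact hs|split; [apply hs|]].
intro u; rewrite hs'; split.
- intros [v [hu hv]]; apply hz' in hv; destruct hv as [->| ->]; [now left|].
  apply hy' in hu; destruct hu; auto.
- intros [hu| ->].
  + exists x; split; [assumption|]; apply hz'; auto.
  + exists y; split; [apply hy'|apply hz']; auto.
Qed.

Lemma succ_unique s s' x : is_succ s x -> is_succ s' x -> s = s'.
Proof.
intros [hs h] [hs' h']; apply (extensionality hM); auto.
intro z; rewrite h, h'; tauto.
Qed.

Lemma succ_mem s x : is_succ s x -> x ∈ s.
Proof. intros [_ h]; apply h; auto. Qed.

(** As for pairs, the biconditional is split so that every quantifier is bounded. *)
Lemma definable_succ i j : definable (fun e => is_succ (e i) (e j)).
Proof.
apply definable_ext with (fun e => is_class (e i) /\ e j ∈ e i /\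
  subclass (e j) (e i) /\ forall z, z ∈ e i -> z ∈ e j \/ z = e j).
- intro e; split; (intros [h h']; split; [assumption|]).
  + destruct h' as [h1 [h2 h3]]; intro w; split; [apply h3|].
    intros [hw| ->]; auto.
  + split; [apply h'; auto|split; [intros z hz; apply h'; auto|apply h']].
- definability.
Qed.
Hint Resolve definable_succ : definability.

(** Well-foundedness speaks of all subclasses, over which a formula cannot quantify. A nonempty
    subclass is a class and not an individual, hence a set when it lies in a set, so quantifying
    over subsets suffices. *)
Lemma definable_ordinal i : definable (fun e => ordinal (e i)).
Proof.
apply definable_ext with (fun e => is_set (e i) /\
  (forall x, x ∈ e i -> is_class x) /\
  (forall x, x ∈ e i -> subclass x (e i)) /\
  (forall x, x ∈ e i -> forall y, y ∈ e i -> x ∈ y \/ x = y \/ y ∈ x) /\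
  (forall s, is_set s -> subclass s (e i) -> (exists x, x ∈ s) ->
     exists m, m ∈ s /\ forall z, z ∈ s -> z ∉ m)).
- intro e; unfold ordinal; split; intros [h1 [h2 [h3 [h4 h5]]]];
    (split; [assumption|split; [assumption|split; [assumption|split]]]).
  + auto.
  + intros s hs hx; apply h5; auto.
    apply subclass_set with (e i); auto.
    destruct hx as [x hx]; exact (mem_class _ _ hx).
  + auto.
  + intros s _; apply h5.
- definability.
Qed.
Hint Resolve definable_ordinal : definability.

Lemma definable_finite_ordinal i : definable (fun e => finite_ordinal (e i)).
Proof.
apply definable_ext with (fun e => ordinal (e i) /\
  forall b, is_element b -> ord_le b (e i) -> is_empty b \/ exists c, is_succ b c).
- intro e; unfold finite_ordinal; split; intros [h h'];
    (split; [assumption|]); [|auto].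
  intros b hb; apply h'; [|assumption].
  destruct hb as [->|hb]; [apply h|element_side].
- definability.
  intros e x [_ h]; exists (e 0); apply h; auto.
Qed.
Hint Resolve definable_finite_ordinal : definability.

(** * Ordinals *)

(** A minimal element of {a, b, c}. It rules out membership cycles of length at most three inside
    [t], in place of foundation. *)
Lemma wf_three t a b c : mem_well_founded_on t -> a ∈ t -> b ∈ t -> c ∈ t ->
  exists m, (m = a \/ m = b \/ m = c) /\ a ∉ m /\ b ∉ m /\ c ∉ m.
Proof.
intros ht ha hb hc.
destruct (class_of (fun x a b c => x = a \/ x = b \/ x = c) a b c)
  as [s [_ hs]]; [definability|].
destruct (ht s) as [m [hm hmin]].
- intros x hx; apply hs in hx; destruct hx as [_ [->|[->| ->]]]; assumption.
- exists a; apply hs; split; [element_side|auto].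
- exists m; split; [apply hs in hm; tauto|].
  repeat split; apply hmin, hs; (split; [element_side|auto]).
Qed.

Lemma ordinal_set x : ordinal x -> is_set x.
Proof. intro h; apply h. Qed.

Lemma ordinal_class x : ordinal x -> is_class x.
Proof. intro h; apply (ordinal_set _ h). Qed.

Lemma ordinal_transitive x : ordinal x -> transitive x.
Proof. intro h; apply h. Qed.

Lemma ordinal_wf x : ordinal x -> mem_well_founded_on x.
Proof. intro h; apply h. Qed.

Lemma transitive_subclass_ordinal a s :
  ordinal a -> is_class s -> subclass s a -> transitive s -> ordinal s.
Proof.
intros [ha1 [ha2 [ha3 [ha4 ha5]]]] hs hsa hst.
split; [exact (subclass_set _ _ ha1 hs hsa)|].
split; [auto|split; [assumption|split; [auto|]]].
intros u hu; apply ha5; intros x hx; auto.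
Qed.

Lemma ordinal_mem a x : ordinal a -> x ∈ a -> ordinal x.
Proof.
intros ha hx; pose proof ha as [ha1 [ha2 [ha3 [ha4 ha5]]]].
apply transitive_subclass_ordinal with a; auto.
intros y hy z hz.
assert (hya : y ∈ a) by exact (ha3 x hx y hy).
assert (hza : z ∈ a) by exact (ha3 y hya z hz).
(* Here [z ∈ y] and [y ∈ x]; both [x ∈ z] and [x = z] would close a cycle, which leaves [z ∈ x]. *)
destruct (wf_three _ x y z ha5 hx hya hza) as [m [hm [h1 [h2 h3]]]].
destruct (ha4 x z hx hza) as [h|[h|h]]; [| |assumption]; exfalso.
- destruct hm as [->|[->| ->]]; contradiction.
- subst z; destruct hm as [->|[->| ->]]; contradiction.
Qed.

Lemma ordinal_irrefl a : ordinal a -> a ∉ a.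
Proof.
intros ha h; destruct (wf_three _ a a a (ordinal_wf _ ha) h h h)
  as [m [hm [h1 _]]].
destruct hm as [->|[->| ->]]; contradiction.
Qed.

Lemma ordinal_asym a b : ordinal a -> a ∈ b -> b ∉ a.
Proof.
intros ha h h'; apply (ordinal_irrefl b); [exact (ordinal_mem _ _ ha h')|].
exact (ordinal_transitive _ (ordinal_mem _ _ ha h') _ h _ h').
Qed.

(** The least element of [b] outside [a] equals [a]. *)
Lemma ordinal_subclass_mem a b :
  ordinal a -> ordinal b -> subclass a b -> a <> b -> a ∈ b.
Proof.
intros ha hb hab hne.
destruct (class_of (fun x a b _ => x ∈ b /\ x ∉ a) a b b) as [d [_ hd]];
  [definability|].
destruct (ordinal_wf _ hb d) as [m [hm hmin]].
- intros x hx; apply hd in hx; tauto.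
- apply NNPP; intro hn; apply hne, (extensionality hM);
    [exact (ordinal_class _ ha)|exact (ordinal_class _ hb)|intro z; split; [auto|]].
  intro hz; apply NNPP; intro hz'; apply hn; exists z; apply hd.
  split; [element_side|auto].
- apply hd in hm; destruct hm as [_ [hmb hma]].
  replace a with m; [assumption|].
  apply (extensionality hM); [exact (proj1 (proj2 hb) m hmb)|exact (ordinal_class _ ha)|].
  intro z; split.
  + intro hz; apply NNPP; intro hza.
    apply (hmin z); [apply hd; split; [element_side|split; [|assumption]]|assumption].
    exact (ordinal_transitive _ hb _ hmb _ hz).
  + intro hz.
    destruct hb as [_ [_ [_ [hlin _]]]].
    destruct (hlin z m (hab z hz) hmb) as [h|[->|h]]; [assumption|contradiction|].
    exfalso; apply hma; exact (ordinal_transitive _ ha _ hz _ h).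
Qed.

(** The intersection of [a] and [b] is an ordinal; if it differed from both, it would belong to both
    and hence to itself. *)
Lemma ordinal_trichotomy a b :
  ordinal a -> ordinal b -> a ∈ b \/ a = b \/ b ∈ a.
Proof.
intros ha hb.
destruct (class_of (fun x a b _ => x ∈ a /\ x ∈ b) a b b) as [c [hc hc']];
  [definability|].
assert (hca : subclass c a) by (intros x hx; apply hc' in hx; tauto).
assert (hcb : subclass c b) by (intros x hx; apply hc' in hx; tauto).
assert (hco : ordinal c).
{ apply transitive_subclass_ordinal with a; auto.
  intros x hx y hy; apply hc'; split; [element_side|split].
  - exact (ordinal_transitive _ ha _ (hca x hx) _ hy).
  - exact (ordinal_transitive _ hb _ (hcb x hx) _ hy). }
destruct (classic (c = a)) as [hea|hna], (classic (c = b)) as [heb|hnb].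
- right; left; congruence.
- left; rewrite <- hea; apply ordinal_subclass_mem; auto.
- right; right; rewrite <- heb; apply ordinal_subclass_mem; auto.
- exfalso; apply (ordinal_irrefl c hco), hc'; split; [apply hco|].
  split; apply ordinal_subclass_mem; auto.
Qed.

(** For well-foundedness, pick any [x] in the subclass [u]: either [x] is already minimal, or a
    minimal element of the part of [u] inside [x] exists because [x] is an ordinal. *)
Lemma transitive_set_of_ordinals s :
  is_set s -> (forall x, x ∈ s -> ordinal x) -> transitive s -> ordinal s.
Proof.
intros hs ho ht; split; [assumption|split; [|split; [assumption|split]]].
- intros x hx; exact (ordinal_class _ (ho x hx)).
- intros; apply ordinal_trichotomy; auto.
- intros u hu [x hx].
  destruct (classic (exists y, y ∈ u /\ y ∈ x)) as [[y hy]|hn].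
  + destruct (class_of (fun y u x _ => y ∈ u /\ y ∈ x) u x x) as [v [_ hv]];
      [definability|].
    destruct (ordinal_wf _ (ho x (hu x hx)) v) as [m [hm hmin]].
    * intros z hz; apply hv in hz; tauto.
    * exists y; apply hv; split; [exact (mem_element _ _ (proj1 hy))|assumption].
    * apply hv in hm; exists m; split; [tauto|].
      intros z hz hzm; apply (hmin z); [|assumption].
      apply hv; split; [element_side|split; [assumption|]].
      apply (ordinal_transitive _ (ho x (hu x hx)) m); tauto.
  + exists x; split; [assumption|]; intros z hz hzx; apply hn; eauto.
Qed.

(** Burali-Forti: otherwise separation from [s] gives the set of all ordinals, an ordinal belonging
    to itself. *)
Lemma ordinals_not_bounded s : is_set s -> exists a, ordinal a /\ a ∉ s.
Proof.
intro hs; apply NNPP; intro hn.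
destruct (separation (fun x _ _ _ => ordinal x) s s s s hs) as [o [ho ho']];
  [definability|].
assert (hall : forall a, ordinal a -> a ∈ o).
{ intros a ha; apply ho'; split; [|assumption].
  apply NNPP; intro; apply hn; eauto. }
assert (h : ordinal o).
{ apply transitive_set_of_ordinals; [assumption| |].
  - intros x hx; apply ho' in hx; tauto.
  - intros x hx y hy; apply hall; apply ho' in hx.
    exact (ordinal_mem _ _ (proj2 hx) hy). }
exact (ordinal_irrefl o h (hall o h)).
Qed.

Lemma succ_ordinal a s : ordinal a -> is_succ s a -> ordinal s.
Proof.
intros ha hs.
destruct (succ_exists _ (ordinal_set _ ha)) as [s' [hs' h]].
rewrite (succ_unique _ _ _ hs h); clear s hs; destruct h as [_ h].
apply transitive_set_of_ordinals; [assumption| |].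
- intros x hx; apply h in hx; destruct hx as [hx| ->]; [|assumption].
  exact (ordinal_mem _ _ ha hx).
- intros x hx y hy; apply h; left; apply h in hx; destruct hx as [hx| ->]; auto.
  exact (ordinal_transitive _ ha _ hx _ hy).
Qed.

Lemma succ_mono a b sa sb : ordinal a -> ordinal b ->
  is_succ sa a -> is_succ sb b -> (a ∈ b <-> sa ∈ sb).
Proof.
intros ha hb hsa hsb; pose proof (succ_ordinal _ _ ha hsa) as hsao; split.
- intro h; destruct (ordinal_trichotomy sa b hsao hb) as [h'|[->|h']].
  + now apply hsb; left.
  + exact (succ_mem _ _ hsb).
  + exfalso; apply hsa in h'; destruct h' as [h'|h'].
    * exact (ordinal_asym _ _ ha h h').
    * subst b; exact (ordinal_irrefl _ ha h).
- intro h; apply hsb in h; destruct h as [h| <-].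
  + exact (ordinal_transitive _ hb _ h _ (succ_mem _ _ hsa)).
  + exact (succ_mem _ _ hsa).
Qed.

Lemma succ_inj a b s : ordinal a -> ordinal b ->
  is_succ s a -> is_succ s b -> a = b.
Proof.
intros ha hb hsa hsb.
destruct (ordinal_trichotomy a b ha hb) as [h|[h|h]]; [exfalso|auto|exfalso];
  apply (ordinal_irrefl s (succ_ordinal _ _ ha hsa)).
- now apply (succ_mono a b s s).
- now apply (succ_mono b a s s).
Qed.

(** * Finite ordinals and omega *)

Lemma empty_unique x y : is_empty x -> is_empty y -> x = y.
Proof.
intros [hx h] [hy h']; apply (extensionality hM); auto.
intro z; split; intro hz; [destruct (h z hz)|destruct (h' z hz)].
Qed.

Lemma empty_exists : exists z, is_set z /\ is_empty z.
Proof.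
destruct (infinity hM) as [I [_ [[z [hz hzI]] _]]].
exists z; split; [split; [apply hz|element_side]|assumption].
Qed.

Lemma empty_finite_ordinal z : is_empty z -> finite_ordinal z.
Proof.
intros hz; destruct empty_exists as [z' [hs hz']].
rewrite (empty_unique _ _ hz hz'); clear z hz.
destruct hz' as [hc hz]; split.
- apply transitive_set_of_ordinals; [assumption| |];
    intros x hx; destruct (hz x hx).
- intros b [->|hb]; [left; now split|destruct (hz b hb)].
Qed.

Lemma finite_ordinal_mem n m : finite_ordinal n -> m ∈ n -> finite_ordinal m.
Proof.
intros [hn h] hm; split; [exact (ordinal_mem _ _ hn hm)|].
intros b [->|hb]; apply h; right; auto.
exact (ordinal_transitive _ hn _ hm _ hb).
Qed.

Lemma finite_ordinal_succ n s :
  finite_ordinal n -> is_succ s n -> finite_ordinal s.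
Proof.
intros [hn h] hs; split; [exact (succ_ordinal _ _ hn hs)|].
intros b [->|hb]; [right; eauto|].
apply hs in hb; apply h; destruct hb as [hb|hb]; [now right|now left].
Qed.

Lemma omega_exists :
  exists w, ordinal w /\ forall x, x ∈ w <-> finite_ordinal x.
Proof.
destruct (infinity hM) as [I [hI [[z [hz hzI]] hsI]]].
assert (hfin : forall x, finite_ordinal x -> x ∈ I).
{ intros n hn; apply NNPP; intro hnI.
  destruct (succ_exists n (ordinal_set _ (proj1 hn))) as [s [_ hs]].
  pose proof (finite_ordinal_succ _ _ hn hs) as hsf.
  (* Working below the successor [s] of [n] makes [n] itself a candidate. The least candidate is
     zero or the successor of a member of [I], so it lies in [I] after all. *)
  destruct (class_of (fun m s I _ => m ∈ s /\ m ∉ I) s I I) as [d [_ hd]];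
    [definability|].
  destruct (ordinal_wf _ (proj1 hsf) d) as [m [hm hmin]].
  - intros x hx; apply hd in hx; tauto.
  - exists n; apply hd; split; [apply hn|split; [exact (succ_mem _ _ hs)|assumption]].
  - apply hd in hm; destruct hm as [_ [hms hmI]]; apply hmI.
    destruct (proj2 hsf m) as [he|[c hc]]; [now right| |].
    + now rewrite (empty_unique _ _ he hz).
    + destruct (hsI c) as [m' [hm' hm'I]]; [|now rewrite (succ_unique _ _ _ hc hm')].
      apply NNPP; intro hcI; apply (hmin c); [|exact (succ_mem _ _ hc)].
      apply hd; split; [exact (mem_element _ _ (succ_mem _ _ hc))|split; [|assumption]].
      exact (ordinal_transitive _ (proj1 hsf) _ hms _ (succ_mem _ _ hc)). }
destruct (separation (fun x _ _ _ => finite_ordinal x) I I I I hI) as [w [hw hw']];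
  [definability|].
assert (h : forall x, x ∈ w <-> finite_ordinal x).
{ intro n; rewrite hw'; split; [tauto|]; auto. }
exists w; split; [|assumption].
apply transitive_set_of_ordinals; [assumption| |].
- intros x hx; apply h in hx; apply hx.
- intros x hx y hy; apply h; apply h in hx; exact (finite_ordinal_mem _ _ hx hy).
Qed.

(** * Order isomorphisms *)

(** Reduces the construction of an isomorphism, which must be a set of ordered pairs, to pointwise
    conditions on a definable relation. *)
Lemma order_iso_graph (P : M -> M -> M -> M -> M -> Prop) a b c X (Q : M -> Prop) :
  definable (fun e => P (e 2) (e 0) (e 4) (e 5) (e 6)) ->
  (forall x y y', P x y a b c -> P x y' a b c -> y = y') -> is_set X ->
  (forall x, x ∈ X -> exists y, is_element y /\ Q y /\ P x y a b c) ->
  (forall y, Q y -> exists x, x ∈ X /\ is_element y /\ P x y a b c) ->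
  (forall x x' y, x ∈ X -> x' ∈ X -> P x y a b c -> P x' y a b c -> x = x') ->
  (forall x x' y y', x ∈ X -> x' ∈ X -> P x y a b c -> P x' y' a b c ->
    (x ∈ x' <-> y ∈ y')) ->
  exists phi, order_iso (fun x => x ∈ X) Q phi.
Proof.
intros hP hf hX hXQ hQX hinj hord.
destruct (graph P a b c X hP hf hX) as [phi [hphi h]].
assert (hr : forall x y, related phi x y <-> x ∈ X /\ is_element y /\ P x y a b c).
{ intros x y; split.
  - intros [p [hp hpp]]; apply h in hpp; destruct hpp as [x' [y' [hx' [hp' hP']]]].
    destruct (opair_inj _ _ _ _ _ hp hp') as [-> ->].
    split; [assumption|split; [element_side|assumption]].
  - intros [hx [hy hxy]].
    destruct (opair_exists x y (mem_element _ _ hx) hy) as [p hp].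
    exists p; split; [assumption|]; apply h; eauto. }
exists phi; split; [assumption|split; [|split; [|split]]].
- intros p hp; apply h in hp; destruct hp as [x [y [hx [hp hxy]]]].
  exists x, y; split; [assumption|split; [assumption|]].
  destruct (hXQ x hx) as [y' [_ [hQ hP']]]; now rewrite (hf _ _ _ hxy hP').
- intros x hx; destruct (hXQ x hx) as [y [hy [hQ hxy]]].
  exists y; split; [now apply hr|].
  intros y' h'; apply hr in h'; apply (hf x); tauto.
- intros y hy; destruct (hQX y hy) as [x [hx [hye hxy]]].
  exists x; split; [now apply hr|].
  intros x' h'; apply hr in h'; apply (hinj _ _ y); tauto.
- intros x x' y y' h1 h2; apply hr in h1; apply hr in h2.
  apply hord; tauto.
Qed.

Lemma order_iso_ext (P P' Q Q' : M -> Prop) phi :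
  (forall x, P x <-> P' x) -> (forall x, Q x <-> Q' x) ->
  order_iso P Q phi -> order_iso P' Q' phi.
Proof.
intros hP hQ [h1 [h2 [h3 [h4 h5]]]].
split; [assumption|split; [|split; [|split; [|assumption]]]].
- intros p hp; destruct (h2 p hp) as [x [y [hxy [hx hy]]]].
  exists x, y; rewrite <- hP, <- hQ; auto.
- intros x hx; apply h3; now apply hP.
- intros x hx; apply h4; now apply hQ.
Qed.

(** The isomorphism is the identity: if [m] is the least point not fixed and [k] its image, all
    elements of [m] are fixed and every element of [k] is the image of an element of [m], so
    [m = k]. *)
Lemma ordinal_iso_eq a b phi : ordinal a -> ordinal b ->
  order_iso (fun x => x ∈ a) (fun x => x ∈ b) phi -> a = b.
Proof.
intros ha hb [_ [hphi [htot [hsurj hord]]]].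
assert (hcod : forall x y, related phi x y -> x ∈ a /\ y ∈ b).
{ intros x y [p [hp h]]; destruct (hphi p h) as [x' [y' [hp' h']]].
  destruct (opair_inj _ _ _ _ _ hp hp') as [-> ->]; assumption. }
assert (hfun : forall x y y', related phi x y -> related phi x y' -> y = y').
{ intros x y y' h h'; destruct (htot x) as [u [_ hu]]; [apply (hcod _ _ h)|].
  transitivity u; [symmetry|]; auto. }
assert (hinj : forall x x' y, related phi x y -> related phi x' y -> x = x').
{ intros x x' y h h'; destruct (hsurj y) as [u [_ hu]]; [apply (hcod _ _ h)|].
  transitivity u; [symmetry|]; auto. }
assert (hid : forall x, x ∈ a -> related phi x x).
{ intros x hx; apply NNPP; intro hn.
  destruct (class_of (fun x a phi _ => x ∈ a /\ ~ related phi x x) a phi phi)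
    as [d [_ hd]]; [definability|].
  destruct (ordinal_wf _ ha d) as [m [hm hmin]].
  - intros u hu; apply hd in hu; tauto.
  - exists x; apply hd; split; [element_side|auto].
  - apply hd in hm; destruct hm as [_ [hma hm]]; apply hm.
    destruct (htot m hma) as [k [hk _]].
    destruct (hcod _ _ hk) as [_ hkb].
    assert (hlt : forall u, u ∈ m -> related phi u u).
    { intros u hu; apply NNPP; intro hnu; apply (hmin u); [|assumption].
      apply hd; split; [element_side|split; [|assumption]].
      exact (ordinal_transitive _ ha _ hma _ hu). }
    assert (hmk : m = k); [|now rewrite hmk in hk at 1; rewrite hmk].
    apply (extensionality hM).
    + exact (ordinal_class _ (ordinal_mem _ _ ha hma)).
    + exact (ordinal_class _ (ordinal_mem _ _ hb hkb)).
    + intro u; split; intro hu.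
      * exact (proj1 (hord _ _ _ _ (hlt u hu) hk) hu).
      * destruct (hsurj u (ordinal_transitive _ hb _ hkb _ hu)) as [v [hv _]].
        assert (hvm : v ∈ m) by exact (proj2 (hord _ _ _ _ hv hk) hu).
        now rewrite (hfun _ _ _ hv (hlt v hvm)). }
apply (extensionality hM); [exact (ordinal_class _ ha)|exact (ordinal_class _ hb)|].
intro u; split; intro hu.
- exact (proj2 (hcod _ _ (hid u hu))).
- destruct (hsurj u hu) as [v [hv _]]; destruct (hcod _ _ hv) as [hva _].
  now rewrite (hfun _ _ _ hv (hid v hva)).
Qed.

(** * Infinite ordinals and the shift by one *)

Section InfiniteLength.

Context {w zero one : M} (hwo : ordinal w)
  (hw : forall x, x ∈ w <-> finite_ordinal x)
  (hzero : is_empty zero) (hone : is_succ one zero).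

(** Comparison with [w] is used instead of the negation of finiteness because it yields the
    inclusion of [w] in [a] at once. *)
Definition infinite_ordinal a := ordinal a /\ ord_le w a.

Lemma zero_mem_omega : zero ∈ w.
Proof. now apply hw, empty_finite_ordinal. Qed.

Lemma succ_mem_omega a s : is_succ s a -> (a ∈ w <-> s ∈ w).
Proof.
intro hs; split.
- intro ha; apply hw; apply hw in ha; exact (finite_ordinal_succ _ _ ha hs).
- intro h; exact (ordinal_transitive _ hwo _ h _ (succ_mem _ _ hs)).
Qed.

(** The ordinal [w], at most [a], is neither empty nor a successor: a predecessor would lie in [w],
    hence so would [w]. *)
Lemma infinite_not_finite a : infinite_ordinal a -> ~ finite_ordinal a.
Proof.
intros [ha hwa] [_ h]; destruct (h w hwa) as [[_ he]|[c hc]].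
- exact (he zero zero_mem_omega).
- apply (ordinal_irrefl w hwo); apply (succ_mem_omega _ _ hc).
  exact (succ_mem _ _ hc).
Qed.

Lemma omega_subclass a : infinite_ordinal a -> subclass w a.
Proof.
intros [ha [<-|h]]; [now intros x|exact (ordinal_transitive _ ha _ h)].
Qed.

Lemma finite_mem_infinite x y : x ∈ w -> ordinal y -> y ∉ w -> x ∈ y.
Proof.
intros hx hy hyw; destruct (ordinal_trichotomy w y hwo hy) as [h|[<-|h]].
- exact (ordinal_transitive _ hy _ h _ hx).
- assumption.
- contradiction.
Qed.

Lemma interval_zero a x : ordinal a -> (interval zero a x <-> x ∈ a).
Proof.
intro ha; split; [intros [_ [_ h]]; assumption|].
intro hx; pose proof (ordinal_mem _ _ ha hx) as hxo.
split; [assumption|split; [|assumption]].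
destruct (ordinal_trichotomy zero x) as [h|[h|h]]; auto.
- apply (ordinal_mem w); [assumption|exact zero_mem_omega].
- now right.
- now left.
- destruct (proj2 hzero x h).
Qed.

Lemma one_ordinal : ordinal one.
Proof. exact (succ_ordinal _ _ (ordinal_mem _ _ hwo zero_mem_omega) hone). Qed.

Lemma interval_one a x :
  ordinal a -> (interval one a x <-> x ∈ a /\ x <> zero).
Proof.
intro ha; split.
- intros [_ [h hx]]; split; [assumption|]; intros ->.
  destruct h as [h|h].
  + apply (proj2 hzero zero); rewrite <- h at 2; exact (succ_mem _ _ hone).
  + exact (proj2 hzero one h).
- intros [hx hne]; pose proof (ordinal_mem _ _ ha hx) as hxo.
  split; [assumption|split; [|assumption]].
  destruct (ordinal_trichotomy one x one_ordinal hxo) as [h|[h|h]].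
  + now right.
  + now left.
  + apply hone in h; destruct h as [h|h]; [destruct (proj2 hzero x h)|contradiction].
Qed.

(* This is the identity [1 + a = a]: finite ordinals are moved up by one, the
   others are fixed. *)
Lemma shift_iso a : infinite_ordinal a ->
  exists phi, order_iso (fun x => x ∈ a) (interval one a) phi.
Proof.
intro hai; pose proof hai as [ha _].
apply (order_iso_graph (fun x y w _ _ => (x ∈ w /\ is_succ y x) \/ (x ∉ w /\ y = x))
  w w w a).
- definability.
- intros x y y' [[h1 h2]|[h1 h2]] [[h3 h4]|[h3 h4]]; try contradiction.
  + exact (succ_unique _ _ _ h2 h4).
  + congruence.
- exact (ordinal_set _ ha).
- intros x hx; destruct (classic (x ∈ w)) as [hxw|hxw].
  + destruct (succ_exists x (ordinal_set _ (ordinal_mem _ _ ha hx)))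
      as [s [hs hsx]].
    exists s; split; [apply hs|split; [|auto]].
    apply interval_one; [assumption|split].
    * apply (omega_subclass a hai); now apply (succ_mem_omega _ _ hsx).
    * intros ->; exact (proj2 hzero x (succ_mem _ _ hsx)).
  + exists x; split; [element_side|split; [|auto]].
    apply interval_one; [assumption|split; [assumption|]].
    intros ->; exact (hxw zero_mem_omega).
- intros y hy; apply interval_one in hy; [|assumption]; destruct hy as [hy hne].
  destruct (classic (y ∈ w)) as [hyw|hyw].
  + pose proof (proj1 (hw y) hyw) as [_ hyf].
    destruct (hyf y) as [he|[c hc]]; [now left| |].
    * destruct (hne (empty_unique _ _ he hzero)).
    * assert (hcw : c ∈ w) by now apply (succ_mem_omega _ _ hc).
      exists c; split; [exact (omega_subclass a hai c hcw)|].
      split; [element_side|auto].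
  + exists y; split; [assumption|split; [element_side|auto]].
- intros x x' y hx hx' [[h1 h2]|[h1 h2]] [[h3 h4]|[h3 h4]].
  + apply (succ_inj x x' y); auto; now apply (ordinal_mem a).
  + subst y; destruct h3; now apply (succ_mem_omega _ _ h2).
  + subst y; destruct h1; now apply (succ_mem_omega _ _ h4).
  + congruence.
- intros x x' y y' hx hx'.
  pose proof (ordinal_mem _ _ ha hx) as hxo.
  pose proof (ordinal_mem _ _ ha hx') as hxo'.
  intros [[h1 h2]|[h1 ->]] [[h3 h4]|[h3 ->]].
  + now apply succ_mono.
  (* Mixed cases: a finite argument stays finite after the shift, so a finite [x] lies below an
     infinite [x'] before and after; in the next case both memberships fail. *)
  + split; intros _; apply finite_mem_infinite; auto.
    now apply (succ_mem_omega _ _ h2).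
  + split; intro h; exfalso; apply h1.
    * exact (ordinal_transitive _ hwo _ h3 _ h).
    * exact (ordinal_transitive _ hwo _ (proj1 (succ_mem_omega _ _ h4) h3) _ h).
  + reflexivity.
Qed.

Lemma identity_iso a : ordinal a ->
  exists phi, order_iso (fun x => x ∈ a) (interval zero a) phi.
Proof.
intro ha.
apply (order_iso_graph (fun x y _ _ _ => y = x) a a a a).
- definability.
- congruence.
- exact (ordinal_set _ ha).
- intros x hx; exists x; split; [element_side|split; [|reflexivity]].
  now apply interval_zero.
- intros y hy; apply interval_zero in hy; [|assumption].
  exists y; split; [assumption|split; [element_side|reflexivity]].
- congruence.
- intros x x' y y' _ _ -> ->; reflexivity.
Qed.

Lemma infinite_length_zero a : infinite_ordinal a -> infinite_length zero a.
Proof.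
intro ha; exists a; split; [split; [apply ha|]|exact (infinite_not_finite a ha)].
exact (identity_iso a (proj1 ha)).
Qed.

Lemma infinite_length_one a : infinite_ordinal a -> infinite_length one a.
Proof.
intro ha; exists a; split; [split; [apply ha|]|exact (infinite_not_finite a ha)].
exact (shift_iso a ha).
Qed.

(** * Skands with constant components *)

Definition constant_family a0 a A f :=
  is_class f /\
  forall p, p ∈ f <-> exists x, interval a0 a x /\ is_opair p x A.

Lemma constant_family_exists a0 a A :
  is_set A -> ordinal a -> exists f, constant_family a0 a A f.
Proof.
intros hA ha.
destruct (graph (fun x y A a0 _ => ordinal x /\ ord_le a0 x /\ y = A) A a0 a0 a)
  as [f [hf h]].
- definability.
- intros x y y' [_ [_ ->]] [_ [_ ->]]; reflexivity.
- exact (ordinal_set _ ha).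
- exists f; split; [apply hf|]; intro p; rewrite h; split.
  + intros [x [y [hx [hp [hxo [hle ->]]]]]]; exists x; now split.
  + intros [x [[hxo [hle hx]] hp]]; exists x, A; auto.
Qed.

Lemma constant_family_related a0 a A f x y : is_set A ->
  constant_family a0 a A f -> (related f x y <-> interval a0 a x /\ y = A).
Proof.
intros hA [_ h]; split.
- intros [p [hp hpf]]; apply h in hpf; destruct hpf as [x' [hx' hp']].
  destruct (opair_inj _ _ _ _ _ hp hp') as [-> ->]; auto.
- intros [hx ->].
  destruct (opair_exists x A) as [p hp]; [apply hx|apply hA|].
  exists p; split; [assumption|]; apply h; eauto.
Qed.

Lemma constant_component_family a0 a A f :
  well_founded_set A -> ordinal a -> a0 ∈ a ->
  constant_family a0 a A f -> component_family a0 a f.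
Proof.
intros hwA ha ha0 hf; pose proof (proj1 hwA) as hA.
pose proof (fun x y => constant_family_related a0 a A f x y hA hf) as hr.
split; [exact (ordinal_mem _ _ ha ha0)|].
split; [assumption|split; [assumption|split; [|split; [|split]]]].
(* [constant_family] only makes [f] a class; it is a set as a subclass of the graph of the constant
   map on all of [a]. *)
- destruct (graph (fun x y A _ _ => y = A) A a a a) as [g [hg hg']].
  + definability.
  + congruence.
  + exact (ordinal_set _ ha).
  + apply subclass_set with g; [assumption|apply hf|].
    intros p hp; apply hf in hp; destruct hp as [x [[_ [_ hx]] hp]].
    apply hg'; eauto.
- intros p hp; apply hf in hp; destruct hp as [x [hx hp]]; eauto.
- intros x hx; exists A; split; [now apply hr|].
  intros y hy; apply hr in hy; symmetry; apply hy.
- intros x y hy; apply hr in hy; destruct hy as [_ ->]; assumption.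
Qed.

(** The intervals from [zero] and [one] differ exactly by [ord_le one x]; injectivity of ordered
    pairs ties this condition to the index of [p]. *)
Lemma constant_tail_family a A f g : ordinal a ->
  constant_family zero a A f ->
  (is_tail_family f one g <-> constant_family one a A g).
Proof.
intros ha [hf h].
assert (hiff : forall p,
  (exists x, interval one a x /\ is_opair p x A) <->
  p ∈ f /\ exists x y, is_opair p x y /\ ord_le one x).
{ intro p; rewrite h; split.
  - intros [x [hx hp]]; split; [|exists x, A; split; [assumption|apply hx]].
    exists x; split; [|assumption]; apply interval_zero; [assumption|apply hx].
  - intros [[x [hx hp]] [x' [y [hp' hle]]]].
    destruct (opair_inj _ _ _ _ _ hp hp') as [<- _].
    exists x; split; [|assumption]; split; [apply hx|split; [assumption|apply hx]]. }
split; intros [hg hg']; (split; [assumption|]); intro p; rewrite hg'.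
- symmetry; apply hiff.
- apply hiff.
Qed.

(** * The reflexive equation and its class of solutions *)

Section Solutions.

Context {Sk A : M} (hexist : skand_existence Sk) (heq : skand_equality Sk)
  (hA : well_founded_set A).

Definition constant_skand a X :=
  infinite_ordinal a /\
  exists f, constant_family zero a A f /\ related Sk f X.

Lemma zero_mem_infinite a : infinite_ordinal a -> zero ∈ a.
Proof. intro ha; exact (omega_subclass a ha _ zero_mem_omega). Qed.

Lemma one_mem_infinite a : infinite_ordinal a -> one ∈ a.
Proof.
intro ha; apply (omega_subclass a ha); apply (succ_mem_omega _ _ hone).
exact zero_mem_omega.
Qed.

Lemma constant_skand_exists a :
  infinite_ordinal a -> exists X, constant_skand a X.
Proof.
intro ha.
destruct (constant_family_exists zero a A (proj1 hA) (proj1 ha)) as [f hf].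
destruct (proj2 hexist zero a f) as [[X [hX _]] _].
- apply (constant_component_family zero a A f hA (proj1 ha)); [|assumption].
  exact (zero_mem_infinite a ha).
- exists X; split; [assumption|]; eauto.
Qed.

(** The equality criterion applies along the shift: corresponding components agree because all of
    them are [A]. *)
Lemma constant_skand_tail a f g X Y : infinite_ordinal a ->
  constant_family zero a A f -> constant_family one a A g ->
  related Sk f X -> related Sk g Y -> X = Y.
Proof.
intros ha hf hg hX hY.
apply (heq zero a one a f g X Y).
- apply (constant_component_family zero a A f hA (proj1 ha)); [|assumption].
  exact (zero_mem_infinite a ha).
- exact (infinite_length_zero a ha).
- apply (constant_component_family one a A g hA (proj1 ha)); [|assumption].
  exact (one_mem_infinite a ha).
- exact (infinite_length_one a ha).
- assumption.
- assumption.
- destruct (shift_iso a ha) as [phi hphi]; exists phi; split.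
  + apply order_iso_ext with (3 := hphi); [|reflexivity].
    intro x; symmetry; apply interval_zero, ha.
  + intros x y u v _ hu hv.
    apply (constant_family_related _ _ _ _ _ _ (proj1 hA) hf) in hu.
    apply (constant_family_related _ _ _ _ _ _ (proj1 hA) hg) in hv.
    destruct hu as [_ ->], hv as [_ ->]; reflexivity.
Qed.

Lemma constant_skand_solves a X :
  constant_skand a X -> solves_reflexive_equation A X.
Proof.
intros [ha [f [hf hX]]].
assert (hcf : component_family zero a f).
{ apply (constant_component_family zero a A f hA (proj1 ha)); [|assumption].
  exact (zero_mem_infinite a ha). }
destruct (proj2 hexist zero a f hcf) as [_ h].
destruct (h X A hX) as [hXs hmem].
{ apply (constant_family_related zero a A); [apply hA|assumption|].
  split; [|reflexivity]; apply interval_zero; [apply ha|].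
  exact (zero_mem_infinite a ha). }
split; [assumption|]; intro y; rewrite hmem.
(* The extra element granted by skand existence is the skand of the tail; it remains to see that it
   is exactly [X]. *)
assert (hy : (exists a1 g, is_succ a1 zero /\ a1 ∈ a /\ is_tail_family f a1 g /\
  related Sk g y) <-> y = X); [|rewrite hy; reflexivity].
split.
- intros [a1 [g [ha1 [_ [hg hy]]]]].
  rewrite (succ_unique _ _ _ ha1 hone) in hg.
  apply (constant_tail_family a A) in hg; [|apply ha|assumption].
  symmetry; exact (constant_skand_tail a f g X y ha hf hg hX hy).
- intros ->.
  destruct (constant_family_exists one a A (proj1 hA) (proj1 ha)) as [g hg].
  destruct (proj2 hexist one a g) as [[Y [hY _]] _].
  { apply (constant_component_family one a A g hA (proj1 ha)); [|assumption].
    exact (one_mem_infinite a ha). }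
  exists one, g; split; [assumption|split; [exact (one_mem_infinite a ha)|split]].
  + apply (constant_tail_family a A); [apply ha|assumption|assumption].
  + now rewrite (constant_skand_tail a f g X Y ha hf hg hX hY).
Qed.

(** The converse direction of the equality criterion, read for [X = X], turns two representations
    into an isomorphism of their index intervals. This is the functionality that replacement
    requires. *)
Lemma constant_skand_length a b X :
  constant_skand a X -> constant_skand b X -> a = b.
Proof.
intros [ha [f [hf hX]]] [hb [g [hg hY]]].
destruct (proj1 (heq zero a zero b f g X X
  (constant_component_family _ _ _ _ hA (proj1 ha) (zero_mem_infinite a ha) hf)
  (infinite_length_zero a ha)
  (constant_component_family _ _ _ _ hA (proj1 hb) (zero_mem_infinite b hb) hg)
  (infinite_length_zero b hb) hX hY) eq_refl) as [phi [hphi _]].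
apply (ordinal_iso_eq a b phi (proj1 ha) (proj1 hb)).
apply order_iso_ext with (3 := hphi); intro x; apply interval_zero; [apply ha|apply hb].
Qed.

Lemma solutions_proper_class : exists S : M, is_proper_class S /\
  forall X, X ∈ S <-> solves_reflexive_equation A X.
Proof.
(* The equation is split so that its quantifiers are bounded by [A] and [X]. *)
destruct (class_of (fun X A _ _ => is_class X /\ X ∈ X /\ subclass A X /\
  forall y, y ∈ X -> y ∈ A \/ y = X) A A A) as [S [hS h]]; [definability|].
assert (h' : forall X, X ∈ S <-> solves_reflexive_equation A X).
{ intro X; rewrite h; split.
  - intros [he [hc [hX [hAX hXA]]]]; split; [now split|].
    intro y; split; [apply hXA|intros [hy| ->]]; auto.
  - intros [[hc he] hX]; split; [assumption|split; [assumption|]].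
    split; [apply hX; auto|split; [intros y hy; apply hX; auto|apply hX]]. }
exists S; split; [|assumption]; split; [assumption|]; intro he.
(* The map from solutions to lengths depends on [w], [A], [zero] and [Sk], one parameter more than
   [image] admits; [K] absorbs the first three. *)
destruct (class_of (fun p w A zero => exists f a, is_opair p f a /\
  (ordinal a /\ ord_le w a) /\ constant_family zero a A f) w A zero) as [K [_ hK]].
{ unfold constant_family, interval; definability. }
assert (hKr : forall f a, related K f a -> infinite_ordinal a /\
  constant_family zero a A f).
{ intros f a [p [hp hpK]]; apply hK in hpK; destruct hpK as [_ [g [b [hq hgb]]]].
  now destruct (opair_inj _ _ _ _ _ hp hq) as [-> ->]. }
destruct (image (fun X a K Sk _ => exists f, related K f a /\ related Sk f X)
  K Sk K S) as [T [hT hT']].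
{ definability. }
{ intros X a b [f [hf hfX]] [g [hg hgX]].
  apply hKr in hf; apply hKr in hg.
  apply (constant_skand_length a b X); (split; [tauto|]); [exists f|exists g]; tauto. }
{ now split. }
(* [T] collects the infinite ordinals only; its union with [w] would be a set containing every
   ordinal. *)
destruct (pairing hM (proj2 (ordinal_set _ hwo)) (proj2 hT)) as [wT [hwT [_ hwT']]].
destruct (union hM hwT) as [U [hU hU']].
destruct (ordinals_not_bounded U hU) as [a [ha haU]]; apply haU, hU'.
destruct (classic (a ∈ w)) as [haw|haw].
{ exists w; split; [assumption|]; apply hwT'; auto. }
exists T; split; [|apply hwT'; auto].
assert (hai : infinite_ordinal a).
{ split; [assumption|]; destruct (ordinal_trichotomy w a hwo ha) as [h0|[h0|h0]].
  - now right.
  - now left.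
  - contradiction. }
destruct (constant_skand_exists a hai) as [X hX].
apply hT'; exists X; split; [apply h'; exact (constant_skand_solves a X hX)|].
split; [apply (ordinal_set _ ha)|].
destruct hX as [_ [f [hf hfX]]]; exists f; split; [|assumption].
destruct (opair_exists f a) as [p hp];
  [element_side|apply (ordinal_set _ ha)|].
exists p; split; [assumption|]; apply hK; split; [element_side|].
exists f, a; split; [assumption|split; assumption].
Qed.

(** A single solution would make the class of solutions a singleton, hence a set. *)
Lemma solutions_not_unique : exists X Y,
  solves_reflexive_equation A X /\ solves_reflexive_equation A Y /\ X <> Y.
Proof.
destruct solutions_proper_class as [S [[hS hSe] hSol]].
destruct (constant_skand_exists w) as [X hX]; [split; [assumption|now left]|].
apply constant_skand_solves in hX.
apply NNPP; intro hn; apply hSe.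
assert (hXe : is_element X) by apply hX.
destruct (pairing hM hXe hXe) as [Y [hYs hY]].
replace S with Y; [apply hYs|].
apply (extensionality hM); [apply hY|assumption|].
intro u; rewrite (proj2 hY u), hSol; split.
- now intros [->| ->].
- intro hu; left; apply NNPP; intro hne; apply hn; eauto.
Qed.

End Solutions.

End InfiniteLength.

Lemma empty_well_founded x : is_set x -> is_empty x -> well_founded_set x.
Proof.
intros hx [_ h]; split; [assumption|exists x].
split; [assumption|split; [|split]].
- intros y hy; destruct (h y hy).
- intros y hy; assumption.
- intros s hs [y hy]; destruct (h y (hs y hy)).
Qed.

End ClassTheory.

Theorem proposition1 (M : class_structure) (hM : NBG M) (Sk : M)
    (hexist : skand_existence Sk) (heq : skand_equality Sk) :
  (exists X : M, is_set X /\ X ∈ X) /\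
  (forall A : M, (forall x : M, x ∈ A -> in_U x) -> well_founded_set A ->
     (exists X Y : M, solves_reflexive_equation A X /\
        solves_reflexive_equation A Y /\ X <> Y) /\
     (exists S : M, is_proper_class S /\
        forall X : M, X ∈ S <-> solves_reflexive_equation A X)).
Proof.
destruct (omega_exists hM) as [w [hwo hw]].
destruct (empty_exists hM) as [zero [hzs hzero]].
destruct (succ_exists hM _ hzs) as [one [_ hone]].
split.
(* For [A] empty the equation becomes X = {X}. *)
- destruct (solutions_not_unique hM hwo hw hzero hone hexist heq
    (empty_well_founded _ hzs hzero)) as [X [_ [[hX hXmem] _]]].
  exists X; split; [assumption|]; apply hXmem; now right.
- intros A _ hA; split.
  + exact (solutions_not_unique hM hwo hw hzero hone hexist heq hA).
  + exact (solutions_proper_class hM hwo hw hzero hone hexist heq hA).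
Qed.
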